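(* Let $A\in\mathcal{Z}(1)$. There exists a positive integer $\mathcal{L}$ such that for every real number $x\ge\mathcal{L}$, $$\mathcal{D}_A(x)=\left\{\left(1+\tfrac ED\lambda-\tfrac d2,-\tfrac ED\right),\left(-1+\tfrac ED\lambda-\tfrac d2,-\tfrac ED\right)\right\}\cup\bigcup_{l=1}^4\left\{\left(s_m^{(l)},t_m^{(l)}\right): m\in\mathbb{N},\ 1\le m\le\left\lfloor\frac{\log(\lfloor x\rfloor-R_l+1-Q_l)-\log P_l+\log(2\sqrt\tau)}{\log(\alpha+\beta\sqrt\tau)}\right\rfloor\right\},$$ where for $l\in\{1,2,3,4\}$: $$P_l=\begin{cases}1-\lambda-(-1)^l\sqrt\tau & \text{if }\lambda<(-1)^{l-1}\sqrt\tau,\\ 1+\lambda+(-1)^l\sqrt\tau & \text{if }\lambda>(-1)^{l-1}\sqrt\tau,\end{cases}$$ $$Q_l=\begin{cases}(-1)^{\lfloor\frac{l-1}{2}\rfloor}\left(\frac ED\lambda-\frac ED-\frac d2\right) & \text{if }\lambda<(-1)^{l-1}\sqrt\tau,\\ (-1)^{\lfloor\frac{l+1}{2}\rfloor}\left(\frac ED\lambda+\frac ED-\frac d2\right) & \text{if }\lambda>(-1)^{l-1}\sqrt\tau,\end{cases}$$ $$R_l=\begin{cases}1 & \text{if }-\sqrt\tau+\frac{1-(-1)^l}{2}<\lambda<\sqrt\tau-\frac{1+(-1)^l}{2},\\ 0 & \text{if }\lambda<-\sqrt\tau+\frac{1-(-1)^l}{2}\text{ or }\lambda>\sqrt\tau-\frac{1+(-1)^l}{2}.\end{cases}$$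 In particular, this holds with $\mathcal{L}=\max\{M'_l: l\in\{1,2,3,4\}\}$, where $$M'_l=\max\left\{|s_1^{(l)}|,|s_{N_0}^{(l)}|,|s_{N_l}^{(l)}|\right\}+\max\left\{|t_1^{(l)}|,|t_{N_0}^{(l)}|,|t_{N_l}^{(l)}|\right\},$$ $$N_0=\begin{cases}\min\left\{m\in\mathbb{N}: u_m>|\lambda|v_m+\left|\frac ED\lambda-\frac d2\right|,\ v_m>\frac{|E|}{D}\right\} & \text{if }|\lambda|<\sqrt\tau,\\ \min\left\{m\in\mathbb{N}: u_m<|\lambda|v_m-\left|\frac ED\lambda-\frac d2\right|,\ v_m>\frac{|E|}{D}\right\} & \text{if }|\lambda|>\sqrt\tau,\end{cases}$$ $$N_l=\begin{cases}1 & \text{if }|\lambda|<\sqrt\tau,\\ \max\left\{1,\left\lceil\frac{\log\left(1+|\lambda|-(-1)^l\frac{|\lambda|}{\lambda}\sqrt\tau\right)-\log(2\sqrt\tau)}{\log(\alpha+\beta\sqrt\tau)}\right\rceil\right\} & \text{if }|\lambda|>\sqrt\tau.\end{cases}$$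
   Context: $\mathbb{N}$ is the set of positive integers. $\mathcal{A}$ denotes the set of all Diophantine equations $au^2+buv+cv^2+du+ev+f=0$ (unknowns $u,v$) with $a,b,c,d,e,f\in\mathbb{Z}$, $a>0$, $\gcd(a,b,c,d,e,f)=1$. For $A\in\mathcal{A}$ put $D=b^2-4ac$, $E=bd-2ae$, $F=d^2-4af$, $N=E^2-DF$. $A$ is an $LA2$-type equation if: (i) $D$ is a non-square positive integer; (ii) $D\mid E$; (iii) $2a\mid b$, $a\mid c$, $2a\mid d$; (iv) $4a^2D\mid N$. $\mathcal{Z}(1)$ is the set of $LA2$-type equations with $\frac{N}{-4a^2D}=1$ (for these, $a=1$). For $A\in\mathcal{Z}(1)$ put $\lambda=\frac b2\in\mathbb{Z}$ and $\tau=\frac D4$, a non-square positive integer. $(\alpha,\beta)\in\mathbb{N}^2$ is the fundamental solution of $\tilde u^2-\tau\tilde v^2=1$, i.e. $\alpha+\beta\sqrt\tau=\inf\{\tilde u+\tilde v\sqrt\tau:(\tilde u,\tilde v)\in\mathbb{Z}^2,\ \tilde u^2-\tau\tilde v^2=1,\ \tilde u+\tilde v\sqrt\tau>1\}$. For $m\in\mathbb{N}$, $u_m=\frac12\{(\alpha+\beta\sqrt\tau)^m+(\alpha-\beta\sqrt\tau)^m\}$ and $v_m=\frac1{2\sqrt\tau}\{(\alpha+\beta\sqrt\tau)^m-(\alpha-\beta\sqrt\tau)^m\}$ (positive integers). For $l\in\{1,2,3,4\}$, $m\in\mathbb{N}$: $s_m^{(l)}=(-1)^{\lfloor l/2\rfloor}u_m-(-1)^{\lfloor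 (l-1)/2\rfloor}\lambda v_m+\left(\frac ED\lambda-\frac d2\right)$ and $t_m^{(l)}=(-1)^{\lfloor (l-1)/2\rfloor}v_m-\frac ED$ (integers). For real $x>0$, $\mathcal{D}_A(x)$ is the set of $(u,v)\in\mathbb{Z}^2$ that satisfy equation $A$ and $|u|+|v|\le x$. *)

(* Defs.v *)
From HB Require Import structures.
From mathcomp Require Import all_boot all_order all_algebra.
From mathcomp Require Import all_classical all_reals all_analysis.

Set Implicit Arguments.
Unset Strict Implicit.
Unset Printing Implicit Defensive.

Import Order.TTheory GRing.Theory Num.Theory.

Local Open Scope classical_set_scope.
Local Open Scope ring_scope.

(* [QuadEq a b c d e f] is the equation
   a u^2 + b u v + c v^2 + d u + e v + f = 0 in the unknowns u, v. *)
Record quad_eq := QuadEq { qa : int; qb : int; qc : int;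
                           qd : int; qe : int; qf : int }.

Definition is_sol (A : quad_eq) (u v : int) : Prop :=
  qa A * u ^+ 2 + qb A * u * v + qc A * v ^+ 2 + qd A * u + qe A * v + qf A = 0.

(* The class written with a calligraphic A in the source. *)
Definition in_calA (A : quad_eq) : Prop :=
  0 < qa A /\
  foldr gcdz 0 [:: qa A; qb A; qc A; qd A; qe A; qf A] = 1.

Definition discD (A : quad_eq) : int := qb A ^+ 2 - 4 * qa A * qc A.
Definition discE (A : quad_eq) : int := qb A * qd A - 2 * qa A * qe A.
Definition discF (A : quad_eq) : int := qd A ^+ 2 - 4 * qa A * qf A.
Definition discN (A : quad_eq) : int := discE A ^+ 2 - discD A * discF A.

Definition is_LA2 (A : quad_eq) : Prop :=
  in_calA A /\
  [/\ 0 < discD A /\ ~ (exists k : int, discD A = k ^+ 2),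
      (discD A %| discE A)%Z,
      [/\ (2 * qa A %| qb A)%Z, (qa A %| qc A)%Z & (2 * qa A %| qd A)%Z] &
      (4 * qa A ^+ 2 * discD A %| discN A)%Z].

Definition in_Z1 (A : quad_eq) : Prop :=
  is_LA2 A /\
  (discN A)%:~R / (- (4 * qa A ^+ 2 * discD A))%:~R = 1 :> rat.

(* All quotients below are taken in the real field. *)
Definition lam (R : realType) (A : quad_eq) : R := (qb A)%:~R / 2.
Definition tau (R : realType) (A : quad_eq) : R := (discD A)%:~R / 4.
Definition EoD (R : realType) (A : quad_eq) : R :=
  (discE A)%:~R / (discD A)%:~R.
Definition hd (R : realType) (A : quad_eq) : R := (qd A)%:~R / 2.

Definition is_fundamental (R : realType) (A : quad_eq) (alpha beta : nat) :
    Prop :=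
  [/\ (0 < alpha)%N, (0 < beta)%N &
      alpha%:R + beta%:R * Num.sqrt (tau R A) =
      inf [set y : R | exists u v : int,
             [/\ u%:~R ^+ 2 - tau R A * v%:~R ^+ 2 = 1,
                 1 < u%:~R + v%:~R * Num.sqrt (tau R A) &
                 y = u%:~R + v%:~R * Num.sqrt (tau R A)]]].

Section Quantities.
Variables (R : realType) (A : quad_eq) (alpha beta : nat).

Local Notation lam := (lam R A).
Local Notation rt := (Num.sqrt (tau R A)).
Local Notation EoD := (EoD R A).
Local Notation hd := (hd R A).

Definition fund : R := alpha%:R + beta%:R * rt.
Definition fund_conj : R := alpha%:R - beta%:R * rt.

Definition useq (m : nat) : R := (fund ^+ m + fund_conj ^+ m) / 2.
Definition vseq (m : nat) : R := (fund ^+ m - fund_conj ^+ m) / (2 * rt).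

Definition sseq (l m : nat) : R :=
  (-1) ^+ l./2 * useq m - (-1) ^+ l.-1./2 * lam * vseq m + (EoD * lam - hd).
Definition tseq (l m : nat) : R := (-1) ^+ l.-1./2 * vseq m - EoD.

(* Since sqrt(tau) is irrational and lambda is an integer when A is in Z(1),
   equality never occurs in the comparisons of lambda with sqrt(tau) below, so
   each [else] branch is the other strict case. *)
Definition Pc (l : nat) : R :=
  if lam < (-1) ^+ l.-1 * rt then 1 - lam - (-1) ^+ l * rt
  else 1 + lam + (-1) ^+ l * rt.

Definition Qc (l : nat) : R :=
  if lam < (-1) ^+ l.-1 * rt
  then (-1) ^+ l.-1./2 * (EoD * lam - EoD - hd)
  else (-1) ^+ l.+1./2 * (EoD * lam + EoD - hd).

Definition Rc (l : nat) : R :=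
  if (- rt + (1 - (-1) ^+ l) / 2 < lam) && (lam < rt - (1 + (-1) ^+ l) / 2)
  then 1 else 0.

Definition mbound (l : nat) (x : R) : int :=
  Num.floor
    ((ln ((Num.floor x)%:~R - Rc l + 1 - Qc l) - ln (Pc l) + ln (2 * rt))
     / ln fund).

Definition N0_set : set nat :=
  [set m | (0 < m)%N /\
     (if `|lam| < rt then useq m > `|lam| * vseq m + `|EoD * lam - hd|
      else useq m < `|lam| * vseq m - `|EoD * lam - hd|) /\
     vseq m > `|(discE A)%:~R| / (discD A)%:~R].

Definition Nl (l : nat) : nat :=
  if `|lam| < rt then 1%N
  else `|Num.max 1%Z
          (Num.ceil ((ln (1 + `|lam| - (-1) ^+ l * (`|lam| / lam) * rt)
                      - ln (2 * rt)) / ln fund))|%N.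

Definition Mbd (N0 l : nat) : R :=
  Num.max (Num.max `|sseq l 1| `|sseq l N0|) `|sseq l (Nl l)| +
  Num.max (Num.max `|tseq l 1| `|tseq l N0|) `|tseq l (Nl l)|.

Definition maxMbd (N0 : nat) : R :=
  Num.max (Num.max (Mbd N0 1) (Mbd N0 2)) (Num.max (Mbd N0 3) (Mbd N0 4)).

Definition sol_set (x : R) : set (int * int) :=
  [set p | is_sol A p.1 p.2 /\ `|p.1|%:~R + `|p.2|%:~R <= x].

Definition param_set (x : R) : set (R * R) :=
  [set (1 + EoD * lam - hd, - EoD)] `|` [set (-1 + EoD * lam - hd, - EoD)] `|`
  \bigcup_(l in [set l : nat | (1 <= l <= 4)%N])
    [set (sseq l m, tseq l m) |
       m in [set m : nat | (1 <= m)%N /\ m%:Z <= mbound l x]].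

(* The parametrised points are a priori real, hence the equality is stated in
   R * R; it includes the fact that they have integer coordinates. *)
Definition description_at (x : R) : Prop :=
  [set ((p.1%:~R : R), (p.2%:~R : R)) | p in sol_set x] = param_set x.

End Quantities.

Definition is_min (S : set nat) (n : nat) : Prop :=
  S n /\ forall k, S k -> (n <= k)%N.

(* Main.v *)
Require Import Defs.
From HB Require Import structures.
From mathcomp Require Import all_boot all_order all_algebra.
From mathcomp Require Import all_classical all_reals all_analysis.
From mathcomp Require Import zify ring lra.

Import Order.TTheory GRing.Theory Num.Theory.

Local Open Scope classical_set_scope.
Local Open Scope ring_scope.

(* In the coordinates W = u + lambda v + d/2 and V = v + E/D the equation is the
   Pell equation W^2 - tau V^2 = 1, so its solutions are (+-1, 0) and the four
   sign branches (+-u_m, +-v_m). On branch l, write S_m = |s_m| + |t_m|. From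
   N_0 on the signs of s_m and t_m are constant and
   S_m = (phi^m P_l + phi^-m P'_l) / (2 sqrt tau) + Q_l, with P'_l the conjugate
   coefficient. The decaying term lies in ]0, 1[ when R_l = 1, and in [-1, 0[
   from N_l on when R_l = 0; as S_m is an integer, S_m <= x is then equivalent
   to the logarithmic bound on m. Below max(N_0, N_l), s_m and t_m are monotone
   in m, so S_m is at most M'_l, and the two exceptional points are no larger
   than the first point of a suitable branch. *)

(** * Comparison through squares; powers of a Pell solution, their growth and completeness *)

Lemma ltr_of_sqr (R : realDomainType) (x y : R) :
  0 <= y -> x ^+ 2 < y ^+ 2 -> x < y.
Proof.
move=> y0; rewrite !ltNge; apply: contra => yx.
by rewrite lerXn2r ?nnegrE // (le_trans y0).
Qed.

Lemma ler_of_sqr (R : realDomainType) (x y : R) :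
  0 <= y -> x ^+ 2 <= y ^+ 2 -> x <= y.
Proof.
move=> y0; rewrite !leNgt; apply: contra => yx.
by rewrite ltrXn2r ?nnegrE // ltW // (le_lt_trans y0).
Qed.

(** The coordinates of the power (a + b sqrt t)^m, given by an integer recursion so that signs and
    growth become integer arithmetic. *)
Fixpoint pell (t a b : int) (m : nat) : int * int :=
  if m is k.+1 then
    let p := pell t a b k in (a * p.1 + t * b * p.2, a * p.2 + b * p.1)
  else (1, 0).

Section Pell.
Variables t a b : int.
Hypotheses (t_gt1 : 1 < t) (a_gt0 : 0 < a) (b_gt0 : 0 < b).
Hypothesis ab1 : a ^+ 2 - t * b ^+ 2 = 1.

Local Notation U m := (pell t a b m).1.
Local Notation V m := (pell t a b m).2.

Lemma pell_norm m : U m ^+ 2 - t * V m ^+ 2 = 1.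
Proof.
elim: m => [|m IH] /=; first by ring.
by rewrite -[RHS]mulr1 -{1}ab1 -IH; ring.
Qed.

Lemma pell_pos m : 0 < U m /\ 0 <= V m.
Proof.
elim: m => [//|m [u0 v0]] /=; split.
  by rewrite ltr_pwDl ?mulr_gt0 ?mulr_ge0 //; lia.
by rewrite addr_ge0 ?mulr_ge0 //; lia.
Qed.

Lemma pell_a_gt1 : 1 < a.
Proof.
apply: ltr_of_sqr; first exact: ltW.
by have : 0 < t * b ^+ 2 by [rewrite mulr_gt0 ?exprn_gt0 //; lia]; lia.
Qed.

Lemma pellV_lt m : V m < V m.+1.
Proof.
have a1 := pell_a_gt1; have [u0 v0] := pell_pos m => /=.
have : 0 < b * U m by rewrite mulr_gt0.
by have : 0 <= (a - 1) * V m by [rewrite mulr_ge0 //; lia]; lia.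
Qed.

Lemma pellV_ge m : m%:Z <= V m.
Proof. by elim: m => [//|m IH]; have := pellV_lt m; lia. Qed.

Lemma pellV_lt_U m : V m < U m.
Proof.
have [u0 v0] := pell_pos m; have := pell_norm m => n1.
apply: ltr_of_sqr; first exact: ltW.
by have : 0 <= (t - 1) * V m ^+ 2 by [rewrite mulr_ge0 ?sqr_ge0 //; lia]; lia.
Qed.

(* Multiplying a solution by the inverse of the fundamental one decreases v. *)
Lemma pell_complete (w v : int) : (forall w' v' : int, 0 < w' -> 0 < v' ->
    w' ^+ 2 - t * v' ^+ 2 = 1 -> b <= v') ->
  0 < w -> 0 < v -> w ^+ 2 - t * v ^+ 2 = 1 ->
  exists m, w = U m.+1 /\ v = V m.+1.
Proof.
move=> bmin; move: {2}`|v|%N (leqnn `|v|%N) => n.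
elim: n w v => [|n IH] w v vn w0 v0 wv1; first by lia.
have bv := bmin _ _ w0 v0 wv1.
pose w' := a * w - t * b * v; pose v' := a * v - b * w.
have n1 : w' ^+ 2 - t * v' ^+ 2 = 1.
  by rewrite -[RHS]mulr1 -{1}ab1 -wv1 /w' /v'; ring.
have ew : w = a * w' + t * b * v'.
  by rewrite -[LHS]mul1r -ab1 /w' /v'; ring.
have ev : v = a * v' + b * w'.
  by rewrite -[LHS]mul1r -ab1 /w' /v'; ring.
(* After squaring and substituting both norm equations, this becomes [b ^+ 2 <= v ^+ 2], the
   minimality of [b]. *)
have v'0 : 0 <= v'.
  rewrite subr_ge0; apply: ler_of_sqr; first by rewrite mulr_ge0 ?mulr_ge0; lia.
  have -> : (b * w) ^+ 2 = b ^+ 2 * (1 + t * v ^+ 2) by rewrite -wv1; ring.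
  have -> : (a * v) ^+ 2 = v ^+ 2 * (1 + t * b ^+ 2) by rewrite -ab1; ring.
  have : b ^+ 2 <= v ^+ 2 by rewrite lerXn2r ?nnegrE ?(ltW b_gt0) ?(ltW v0).
  by lia.
have v'v : v' < v.
  suff : (a - 1) * v < b * w by rewrite /v'; lia.
  apply: ltr_of_sqr; first by rewrite mulr_ge0 ?mulr_ge0; lia.
  have -> : (b * w) ^+ 2 = b ^+ 2 + (t * b ^+ 2) * v ^+ 2.
    by rewrite exprMn -[w ^+ 2](subrK (t * v ^+ 2)) wv1; ring.
  have -> : t * b ^+ 2 = a ^+ 2 - 1 by rewrite -ab1; ring.
  have : 0 < b ^+ 2 by rewrite exprn_gt0.
  have : 0 <= (2 * a - 2) * v ^+ 2 by rewrite mulr_ge0 ?sqr_ge0; lia.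
  by lia.
have w'0 : 0 < w'.
  rewrite subr_gt0; apply: ltr_of_sqr; first by rewrite mulr_ge0 ?mulr_ge0; lia.
  have -> : (t * b * v) ^+ 2 = (t * b ^+ 2) * (t * v ^+ 2) by ring.
  have -> : (a * w) ^+ 2 = (1 + t * b ^+ 2) * (1 + t * v ^+ 2).
    by rewrite -{1}ab1 -wv1; ring.
  have : 0 <= t * b ^+ 2 by rewrite mulr_ge0 ?sqr_ge0; lia.
  have : 0 <= t * v ^+ 2 by rewrite mulr_ge0 ?sqr_ge0; lia.
  by lia.
(* If [v'] vanishes, (w, v) is the fundamental solution itself, at exponent 1; otherwise the
   induction hypothesis applies to the smaller [v']. *)
have [v'z|v'p] := eqVneq v' 0.
  have w'1 : w' = 1.
    apply/eqP; rewrite -(@eqrXn2 _ 2) ?ltW // expr1n -n1 v'z.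
    by apply/eqP; ring.
  by exists 0%N; rewrite /= ew ev v'z w'1; split; ring.
have [||m [wm vm]] := IH w' v' _ w'0 _ n1; [lia|lia|].
by exists m.+1; rewrite ew ev wm vm /=; split; ring.
Qed.

(* The coefficient tb - k(a-1) is positive, as
   t^2 b^2 = t(a^2-1) > k^2 (a-1)^2. *)
Lemma pell_gap_lt (k : int) m : k ^+ 2 < t ->
  U m - k * V m + V m <= U m.+1 - k * V m.+1.
Proof.
move=> kt; have [u0 v0] := pell_pos m; have a1 := pell_a_gt1.
have h1 : k * b < a.
  apply: ltr_of_sqr; first exact: ltW.
  have : k ^+ 2 * b ^+ 2 <= t * b ^+ 2 by rewrite ler_wpM2r ?sqr_ge0 ?ltW.
  by rewrite exprMn; lia.
have h2 : k * (a - 1) < t * b.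
  apply: ltr_of_sqr; first by rewrite mulr_ge0; lia.
  have -> : (t * b) ^+ 2 = t * (a ^+ 2 - 1) by rewrite -ab1; ring.
  have h : k ^+ 2 * (a - 1) ^+ 2 <= t * (a - 1) ^+ 2.
    by rewrite ler_wpM2r ?sqr_ge0 ?ltW.
  have : 0 < t * (2 * a - 2) by rewrite mulr_gt0; lia.
  by rewrite exprMn; lia.
have : 0 <= (a - k * b - 1) * U m by rewrite mulr_ge0; lia.
have : 0 <= (t * b - k * (a - 1) - 1) * V m by rewrite mulr_ge0; lia.
by rewrite /=; lia.
Qed.

(* The increment of (U, V) is (U, V) * (a-1, b), of norm 2 - 2a < 0. *)
Lemma pell_gap_gt (k : int) m : 0 <= k -> t < k ^+ 2 ->
  k * V m - U m < k * V m.+1 - U m.+1.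
Proof.
move=> k0 tk; have [u0 v0] := pell_pos m; have a1 := pell_a_gt1.
suff : U m.+1 - U m < k * (V m.+1 - V m) by lia.
have dv := pellV_lt m.
apply: ltr_of_sqr; first by rewrite mulr_ge0; lia.
have e : (U m.+1 - U m) ^+ 2 - t * (V m.+1 - V m) ^+ 2 = 2 - 2 * a.
  have -> : 2 - 2 * a = ((a - 1) ^+ 2 - t * b ^+ 2) * (U m ^+ 2 - t * V m ^+ 2).
    have -> : t * b ^+ 2 = a ^+ 2 - 1 by rewrite -ab1; ring.
    by rewrite pell_norm; ring.
  by rewrite /=; ring.
have : t * (V m.+1 - V m) ^+ 2 <= k ^+ 2 * (V m.+1 - V m) ^+ 2.
  by rewrite ler_wpM2r ?sqr_ge0 ?ltW.
by rewrite exprMn; lia.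
Qed.

Lemma pellU_le m : U m <= U m.+1.
Proof.
have [u0 v0] := pell_pos m; have a1 := pell_a_gt1.
have : 0 <= t * b * V m by rewrite !mulr_ge0; lia.
have : 0 <= (a - 1) * U m by rewrite mulr_ge0; lia.
by rewrite /=; lia.
Qed.

End Pell.

(** * The dominant term of s_m and the quantity that governs N_0 *)

Section Dominant.
Variables t a b : int.
Hypotheses (t_gt1 : 1 < t) (a_gt0 : 0 < a) (b_gt0 : 0 < b).
Hypothesis ab1 : a ^+ 2 - t * b ^+ 2 = 1.
Variable k : int.
Hypothesis kt : k ^+ 2 != t.

Local Notation U m := (pell t a b m).1.
Local Notation V m := (pell t a b m).2.

(** The quantity that the definition of N_0 compares with |(E/D) lambda - d/2|; the test
    [k ^+ 2 < t] stands for |lambda| < sqrt tau. *)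
Definition pell_gap (m : nat) : int :=
  if k ^+ 2 < t then U m - `|k| * V m else `|k| * V m - U m.

(* For g = 1 or -1, the sign of g U_m - k V_m for large m. *)
Definition dom_sign (g : int) : int := if k ^+ 2 < t then g else - sgz k.

(** Strictness can fail at m = 0: t = 2, a = 3, b = 2, k = 1 gives the value 1 at both m = 0 and m =
    1. *)
Lemma pell_gap_ltS m : (0 < m)%N -> pell_gap m < pell_gap m.+1.
Proof.
move=> m0; have vm := pellV_ge _ _ _ t_gt1 a_gt0 b_gt0 ab1 m; rewrite /pell_gap.
case: (ltP (k ^+ 2) t) => [kl|kg].
  have := pell_gap_lt _ _ _ t_gt1 a_gt0 b_gt0 ab1 `|k| m.
  by rewrite real_normK ?num_real // => /(_ kl); lia.
have := pell_gap_gt _ _ _ t_gt1 a_gt0 b_gt0 ab1 `|k| m.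
by rewrite real_normK ?num_real // lt_neqAle eq_sym kt kg; apply.
Qed.

Lemma pell_gap_le m n : (0 < m)%N -> (m <= n)%N -> pell_gap m <= pell_gap n.
Proof.
move=> m0; elim: n => [|n IH]; first by rewrite leqn0 => /eqP ->.
rewrite leq_eqVlt => /predU1P[->//|mn]; apply: (le_trans (IH mn)).
by apply/ltW/pell_gap_ltS/(leq_trans m0).
Qed.

Lemma pell_gap_unbounded (c : int) : exists2 m, (0 < m)%N & c < pell_gap m.
Proof.
have H m : m%:Z + pell_gap 1 <= pell_gap m.+1.
  elim: m => [|m IH]; first by lia.
  by have := pell_gap_ltS m.+1 isT; lia.
by exists (`|c - pell_gap 1|.+1).+1 => //; have := H `|c - pell_gap 1|.+1; lia.
Qed.

Lemma dom_signP g : g = 1 \/ g = -1 -> dom_sign g = 1 \/ dom_sign g = -1.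
Proof.
move=> g1; rewrite /dom_sign; case: (ltP (k ^+ 2) t) => // tk.
have k0 : k != 0.
  by apply: contraTN tk => /eqP ->; rewrite expr0n -ltNge; lia.
by case: sgzP k0 => //; lia.
Qed.

(** For either [g], the sign makes the dominant term positive, and the other term subtracts at most
    its absolute value. Hence one N_0 serves all four branches. *)
Lemma pell_gap_le_dom g m : g = 1 \/ g = -1 ->
  pell_gap m <= dom_sign g * (g * U m - k * V m).
Proof.
move=> g1; have [u0 v0] := pell_pos _ _ _ t_gt1 a_gt0 b_gt0 ab1 m.
rewrite /pell_gap /dom_sign; case: (ltP (k ^+ 2) t) => tk.
  have : 0 <= (`|k| - g * k) * V m by rewrite mulr_ge0; lia.
  by case: g1 => -> /=; lia.
have -> : - sgz k * (g * U m - k * V m) = `|k| * V m - sgz k * g * U m.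
  by rewrite [`|k|]normrEsg sgrz; ring.
have : 0 <= (1 - sgz k * g) * U m.
  rewrite mulr_ge0 ?(ltW u0) //.
  by case: sgzP; case: g1 => ->; lia.
by lia.
Qed.

(** If [k ^+ 2 < t], [pell_gap_lt] applies with [g * k]. Otherwise, for nonzero [k], the expression
    is |k| V_m minus or plus U_m: the first grows by [pell_gap_gt], the second because U and V
    do. *)
Lemma dom_mono g m : g = 1 \/ g = -1 ->
  dom_sign g * (g * U m - k * V m) <= dom_sign g * (g * U m.+1 - k * V m.+1).
Proof.
move=> g1; have [u0 v0] := pell_pos _ _ _ t_gt1 a_gt0 b_gt0 ab1 m.
rewrite /dom_sign; case: (ltP (k ^+ 2) t) => tk.
  have := pell_gap_lt _ _ _ t_gt1 a_gt0 b_gt0 ab1 (g * k) m.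
  have -> : (g * k) ^+ 2 = k ^+ 2 by case: g1 => ->; ring.
  by move=> /(_ tk); case: g1 => ->; lia.
have := pell_gap_gt _ _ _ t_gt1 a_gt0 b_gt0 ab1 `|k| m.
rewrite real_normK ?num_real // lt_neqAle eq_sym kt tk.
move=> /(_ (normr_ge0 _) isT).
have := pellU_le _ _ _ t_gt1 a_gt0 b_gt0 ab1 m.
have := pellV_lt _ _ _ t_gt1 a_gt0 b_gt0 ab1 m.
move: (U m.+1) (V m.+1) => U' V'.
by case: sgzP; case: g1 => ->; lia.
Qed.

End Dominant.

(** * The logarithmic form of an exponential bound *)

(** Multiply by [ln phi], which is positive, and exponentiate. Positivity of [w] matters: [ln] has
    the default value 0 at nonpositive reals. *)
Lemma le_floor_log_ratio (R : realType) (phi c P w : R) (m : nat) :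
  1 < phi -> 0 < c -> 0 < P -> 0 < w ->
  (m%:Z <= Num.floor ((ln w - ln P + ln c) / ln phi)) = (phi ^+ m * P <= c * w).
Proof.
move=> phi1 c0 P0 w0; have phi0 : 0 < phi by rewrite (lt_trans ltr01).
rewrite floor_ge_int ler_pdivlMr ?ln_gt0 //.
rewrite -[RHS]ler_ln ?posrE ?mulr_gt0 ?exprn_gt0 //.
rewrite !lnM ?posrE ?exprn_gt0 // lnXn // -mulr_natl.
by apply/idP/idP; lra.
Qed.

(* Up to the index M both sides hold; beyond it, the conjugate term
   phi^-m P' / c has absolute value at most 1, so that it is absorbed
   when comparing integers. *)
Lemma le_iff_le_floor_log (R : realType) (phi c P P' r x : R) (q : int)
    (f : nat -> int) (M m : nat) :
  1 < phi -> 0 < c -> 0 < P -> (0 < M)%N ->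
  (forall k, (0 < k <= M)%N -> (f k)%:~R <= x) ->
  (forall k, (M <= k)%N ->
     (f k)%:~R = (phi ^+ k * P + phi ^- k * P') / c + q%:~R) ->
  (r = 1 /\ 0 < P' < c) \/ [/\ r = 0, P' < 0 & - P' <= c * phi ^+ M] ->
  (0 < m)%N ->
  (f m)%:~R <= x <->
  m%:Z <= Num.floor ((ln ((Num.floor x)%:~R - r + 1 - q%:~R) - ln P + ln c)
                     / ln phi).
Proof.
move=> phi1 c0 P0 M0 fx fE hr m0.
have phi0 : 0 < phi by rewrite (lt_trans ltr01).
set n := Num.floor x; set w := n%:~R - r + 1 - q%:~R.
have key k : (M <= k)%N -> (f k <= n) = (phi ^+ k * P <= c * w).
  move=> Mk; have := fE k Mk.
  have Y0 : 0 < phi ^+ k by rewrite exprn_gt0.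
  have y0 : 0 < phi ^- k by rewrite invr_gt0.
  have y1 : phi ^- k < 1.
    by rewrite invf_lt1 // exprn_egt1 // -lt0n (leq_trans M0).
  have yM : phi ^- k * phi ^+ M <= 1.
    by rewrite mulrC ler_pdivrMr // mul1r ler_eXn2l.
  move: (phi ^+ k) (phi ^- k) (phi ^+ M) Y0 y0 y1 yM hr => Y y Z Y0 y0 y1 yM hr.
  move=> E.
  have {}E : c * ((f k)%:~R - q%:~R) = Y * P + y * P'.
    by rewrite E addrK mulrC divfK ?gt_eqF.
  (* An integer inequality reads [<= n] or [< n + 1]: forward implications start from the first form
     and converses reach the second, which leaves room [c] for the conjugate term. *)
  have leE : (f k <= n) = (c * ((f k)%:~R - q%:~R) <= c * (n%:~R - q%:~R)).
    by rewrite ler_pM2l // lerD2r ler_int.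
  have ltE : (f k <= n) = (c * ((f k)%:~R - q%:~R) < c * (n%:~R + 1 - q%:~R)).
    by rewrite ltr_pM2l // ltrD2r -intrD1 ltr_int ltzD1.
  case: hr => [[r1 /andP[P'0 P'c]]|[r0 P'0 P'c]].
    have yP' : 0 < y * P' by rewrite mulr_gt0.
    have yP'' : y * P' < c.
      by rewrite (lt_trans _ P'c) // gtr_pMl.
    have -> : c * w = c * (n%:~R - q%:~R) by rewrite /w r1; ring.
    apply/idP/idP => [|h]; first by rewrite leE; lra.
    by rewrite ltE; lra.
  have yP' : y * P' < 0 by rewrite pmulr_rlt0.
  have yP'' : - (y * P') <= c.
    have : y * (- P') <= y * (c * Z) by rewrite ler_pM2l.
    have : c * (y * Z) <= c * 1 by rewrite ler_pM2l.
    by lra.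
  have -> : c * w = c * (n%:~R + 1 - q%:~R) by rewrite /w r0; ring.
  apply/idP/idP => [|h]; first by rewrite leE; lra.
  by rewrite ltE; lra.
have fxM : phi ^+ M * P <= c * w.
  by rewrite -key // floor_ge_int fx // M0 /=.
have w0 : 0 < w.
  rewrite -(pmulr_rgt0 _ c0); apply: lt_le_trans fxM.
  by rewrite mulr_gt0 ?exprn_gt0.
rewrite le_floor_log_ratio //.
have [Mm|mM] := leqP M m; first by rewrite -key // floor_ge_int.
split=> _; last by rewrite fx // m0 ltnW.
apply: le_trans fxM; rewrite ler_pM2r // ler_eXn2l //; exact: ltnW.
Qed.

(** * Reduction of the equation to a Pell equation *)

Lemma sqr_eq_mul_sqr (t x y : int) :
  x ^+ 2 = t * y ^+ 2 -> y != 0 -> exists j, t = j ^+ 2.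
Proof.
move=> xy y0; have : (y ^+ 2 %| x ^+ 2)%Z by rewrite xy dvdz_mull.
rewrite dvdz_pexp2r // => /dvdzP[j xj]; exists j.
by apply: (mulIf (expf_neq0 2 y0)); rewrite -xy xj exprMn.
Qed.

(** The values of E and N express the last two coefficients as multiples of [a]. With the
    divisibilities in the definition, [a] divides all six coefficients, so a = 1 by the gcd
    condition; completing squares does the rest. *)
Lemma in_Z1_pell (A : quad_eq) : in_Z1 A ->
  exists t k e h : int,
    [/\ 1 < t, ~ (exists j, t = j ^+ 2),
        [/\ qb A = 2 * k, qd A = 2 * h, discD A = 4 * t
          & discE A = 4 * t * e] &
        forall u v,
          is_sol A u v <-> (u + k * v + h) ^+ 2 - t * (v + e) ^+ 2 = 1].
Proof.
case: A => a b c d ee f [[[/= a0 gcd1] [[D0 Dsq] /dvdzP[e De] H _]] N1].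
move: H => [/dvdzP[k bk] /dvdzP[c' cc] /dvdzP[h dh]].
rewrite /= in bk cc dh; pose t := k ^+ 2 - c'.
have Dt : discD (QuadEq a b c d ee f) = 4 * a ^+ 2 * t.
  by rewrite /discD /= /t bk cc; ring.
have t0 : 0 < t.
  by rewrite -(@pmulr_rgt0 _ (4 * a ^+ 2)) -?Dt // mulr_gt0 // exprn_gt0.
have tns : ~ (exists j, t = j ^+ 2).
  by move=> [j tj]; apply: Dsq; exists (2 * a * j); rewrite Dt tj; ring.
have t1 : 1 < t.
  rewrite lt_neqAle; apply/andP; split; last by lia.
  by apply/eqP => t1; apply: tns; exists 1; rewrite -t1.
have NE : discN (QuadEq a b c d ee f) = - (4 * a ^+ 2 * (4 * a ^+ 2 * t)).
  move: N1; rewrite Dt /= => N1.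
  have nz : (- (4 * a ^+ 2 * (4 * a ^+ 2 * t)))%:~R != 0 :> rat.
    by rewrite intr_eq0 oppr_eq0 !mulf_neq0 ?gt_eqF ?exprn_gt0.
  by move/(canRL (divfK nz)): N1; rewrite mul1r => /intr_inj.
have ae : ee = 2 * a * (k * h - t * e).
  apply: (mulfI (_ : 2 * a != 0)); first by rewrite mulf_neq0 ?gt_eqF.
  have : discE (QuadEq a b c d ee f) = e * (4 * a ^+ 2 * t) by rewrite De Dt.
  by rewrite /discE /= bk dh; lia.
have af : f = a * (h ^+ 2 - t * e ^+ 2 - 1).
  apply: (mulfI (_ : 4 * a * (4 * a ^+ 2 * t) != 0)).
    by rewrite !mulf_neq0 ?gt_eqF ?exprn_gt0.
  by move: NE; rewrite /discN De Dt /discF /= dh; lia.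
have a1 : a = 1.
  have : (a %| gcdz a (gcdz b (gcdz c (gcdz d (gcdz ee (gcdz f 0))))))%Z.
    have dv x y : y = a * x -> (a %| y)%Z by move=> ->; exact: dvdz_mulr.
    rewrite !dvdz_gcd dvdzz dvdz0 (dv (2 * k) b) ?(dv c' c) ?(dv (2 * h) d)
      ?(dv (2 * (k * h - t * e)) ee) ?(dv (h ^+ 2 - t * e ^+ 2 - 1) f) //;
      rewrite ?bk ?cc ?dh ?ae; ring.
  by rewrite gcd1 dvdz1; lia.
exists t, k, e, h; split=> //.
  by rewrite De Dt bk dh a1; split; ring.
move=> u v; rewrite /is_sol /= af ae dh bk cc a1.
have -> : c' = k ^+ 2 - t by rewrite /t; ring.
rewrite (_ : _ + _ = (u + k * v + h) ^+ 2 - t * (v + e) ^+ 2 - 1); last by ring.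
by split=> [/subr0_eq //|->]; rewrite subrr.
Qed.

(** * The fundamental solution as an infimum *)

Section Fundamental.
Variables (R : realType) (A : quad_eq) (t : int).
Hypotheses (tauE : tau R A = t%:~R) (t_gt1 : 1 < t).
Hypothesis t_nonsquare : ~ (exists j, t = j ^+ 2).

Local Notation rt := (Num.sqrt (tau R A)).

Lemma sqr_rt : rt ^+ 2 = t%:~R.
Proof. by rewrite sqr_sqrtr tauE // ler0z; lia. Qed.

Lemma rt_gt1 : 1 < rt.
Proof. by rewrite -[1]sqrtr1 ltr_sqrt tauE ?ltr1z // ltr0z; lia. Qed.

Lemma rt_independent (x y x' y' : int) :
  x%:~R + y%:~R * rt = x'%:~R + y'%:~R * rt -> x = x' /\ y = y'.
Proof.
move=> E; have e : (x' - x)%:~R = (y - y')%:~R * rt.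
  by rewrite !rmorphB /=; lra.
have e2 : (x' - x) ^+ 2 = t * (y - y') ^+ 2.
  apply: (@intr_inj R).
  by rewrite rmorphXn rmorphM rmorphXn /= e exprMn sqr_rt mulrC.
have yy : y = y'.
  apply/eqP; rewrite -subr_eq0; apply/negP => /negP ny.
  by apply: t_nonsquare; apply: sqr_eq_mul_sqr e2 ny.
by split=> //; move/eqP: e2; rewrite yy subrr expr0n mulr0 sqrf_eq0; lia.
Qed.

Lemma rt_neq_int (x : int) : rt != x%:~R.
Proof.
apply/eqP => E; have [] := @rt_independent x 0 0 1 => //.
by rewrite mul0r mul1r add0r addr0.
Qed.

Lemma int_norm (u v : int) :
  u%:~R ^+ 2 - tau R A * v%:~R ^+ 2 = 1 :> R <-> u ^+ 2 - t * v ^+ 2 = 1.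
Proof.
rewrite tauE; split=> E; last first.
  by rewrite -[RHS](mulr1z 1) -E rmorphB rmorphXn rmorphM rmorphXn.
by apply: (@intr_inj R); rewrite rmorphB rmorphXn rmorphM rmorphXn.
Qed.

(** The conjugate is the inverse, hence lies in ]0, 1[ when the number exceeds 1; half the sum and
    half the difference are then positive. *)
Lemma pell_gt1_pos (u v : int) : u ^+ 2 - t * v ^+ 2 = 1 ->
  (1 < u%:~R + v%:~R * rt) = (0 < u) && (0 < v).
Proof.
move=> n1; have r1 := rt_gt1.
apply/idP/andP => [y1|[u0 v0]]; last first.
  have : 1%:~R <= u%:~R :> R by rewrite ler_int; lia.
  have : 0 < v%:~R * rt by rewrite mulr_gt0 ?ltr0z //; lra.
  by rewrite mulr1z; lra.
have yz : (u%:~R + v%:~R * rt) * (u%:~R - v%:~R * rt) = 1.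
  by rewrite mulrC -subr_sqr exprMn sqr_rt -(mulrC t%:~R) -[RHS](mulr1z 1) -n1
    rmorphB rmorphXn rmorphM rmorphXn.
have z0 : 0 < u%:~R - v%:~R * rt.
  by rewrite -(pmulr_rgt0 _ (lt_trans ltr01 y1)) yz.
have z1 : u%:~R - v%:~R * rt < 1.
  by move: y1; rewrite -(ltr_pM2r z0) yz mul1r.
split; rewrite -(ltr0z R); first by lra.
have : 0 < v%:~R * rt by lra.
by rewrite pmulr_lgt0 //; lra.
Qed.

(** The infimum is attained at the least positive v, since u grows with v; independence of 1 and
    sqrt tau then recovers both coordinates from the real equation. *)
Lemma fundamental_pell (al be : nat) : is_fundamental R A al be ->
  [/\ al%:Z ^+ 2 - t * be%:Z ^+ 2 = 1, 0 < al%:Z, 0 < be%:Z &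
      forall w v : int, 0 < w -> 0 < v -> w ^+ 2 - t * v ^+ 2 = 1 ->
      be%:Z <= v].
Proof.
move=> [al0 be0]; set S := (X in inf X) => infS.
have r1 := rt_gt1.
(* The infimum of the empty set is 0 by convention, while the given number is positive. *)
have S0 : S !=set0.
  apply/set0P/eqP => S0; move: infS; rewrite S0 inf0.
  have : 0 < al%:R :> R by rewrite ltr0n.
  have : 0 < be%:R * rt by rewrite mulr_gt0 ?ltr0n //; lra.
  by lra.
pose p n := `[< exists u : int, 0 < u /\ u ^+ 2 - t * n.+1%:Z ^+ 2 = 1 >].
have exp : exists n, p n.
  case: S0 => y [u [v [/int_norm n1 y1 _]]].
  move: y1; rewrite pell_gt1_pos // => /andP[u0 v0].
  exists `|v|%N.-1; apply/asboolP; exists u; split=> //.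
  by have -> : `|v|%N.-1.+1%:Z = v by lia.
have [n /asboolP[u [u0 n1]] nmin] := ex_minnP exp.
have minS w v : 0 < w -> 0 < v -> w ^+ 2 - t * v ^+ 2 = 1 -> n.+1%:Z <= v.
  move=> w0 v0 wv1; have : p `|v|%N.-1.
    apply/asboolP; exists w; split=> //.
    by have -> : `|v|%N.-1.+1%:Z = v by lia.
  by move=> /nmin; lia.
have lbS : lbound S (u%:~R + n.+1%:~R * rt).
  move=> y [w [v [/int_norm wv1 y1 ->]]].
  move: y1; rewrite pell_gt1_pos // => /andP[w0 v0].
  have nv := minS _ _ w0 v0 wv1.
  have uw : u <= w.
    apply: ler_of_sqr; first exact: ltW.
    have : t * n.+1%:Z ^+ 2 <= t * v ^+ 2.
      by rewrite ler_pM2l ?lerXn2r ?nnegrE //; lia.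
    by lia.
  apply: lerD; first by rewrite ler_int.
  by rewrite ler_wpM2r ?ler_int //; lra.
have inS : S (u%:~R + n.+1%:~R * rt).
  by exists u, n.+1; split => //; [exact/int_norm|rewrite pell_gt1_pos // u0].
have infE : inf S = u%:~R + n.+1%:~R * rt.
  apply/eqP; rewrite eq_le lb_le_inf // andbT ge_inf //.
  by exists (u%:~R + n.+1%:~R * rt).
move: infS; rewrite infE => /(@rt_independent al be u n.+1)[alu ben].
by rewrite alu ben; split.
Qed.

End Fundamental.

(** * The four branches: integrality, monotonicity and size *)

(** The absolute value is convex, so its maximum over an interval is at an end. This is why M'_l
    involves only the end indices. *)
Lemma ler_norm_mid (x y z c w : int) : w = 1 \/ w = -1 -> x <= y -> y <= z ->
  `|w * y + c| <= Num.max `|w * x + c| `|w * z + c|.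
Proof. by move=> w1 xy yz; rewrite le_max; case: w1 => ->; lia. Qed.

Lemma intr_max (R : numDomainType) (x y : int) :
  (Num.max x y)%:~R = Num.max x%:~R y%:~R :> R.
Proof. by rewrite /Order.max ltr_int; case: ifP. Qed.

Section Branches.
Variables (R : realType) (A : quad_eq) (t k e h : int) (al be : nat).
Hypotheses (t_gt1 : 1 < t) (t_nonsquare : ~ (exists j, t = j ^+ 2)).
Hypotheses (lamE : lam R A = k%:~R) (tauE : tau R A = t%:~R).
Hypotheses (EoDE : EoD R A = e%:~R) (hdE : hd R A = h%:~R).
Hypothesis absEoDE : `|(discE A)%:~R| / (discD A)%:~R = `|e|%:~R :> R.
Hypotheses (al_gt0 : 0 < al%:Z) (be_gt0 : 0 < be%:Z).
Hypothesis ab1 : al%:Z ^+ 2 - t * be%:Z ^+ 2 = 1.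

Local Notation rt := (Num.sqrt (tau R A)).
Local Notation U m := (pell t al be m).1.
Local Notation V m := (pell t al be m).2.
Local Notation phi := (fund R A al be).
Local Notation kap := (e * k - h).

Lemma k2_neq_t : k ^+ 2 != t.
Proof. by apply/eqP => kt; apply: t_nonsquare; exists k. Qed.

Lemma fund_exp m : phi ^+ m = (U m)%:~R + (V m)%:~R * rt.
Proof.
elim: m => [|m IH]; first by rewrite mul0r addr0.
rewrite exprS IH /fund /= !intrD !intrM -!pmulrn -(sqr_rt R A t tauE t_gt1).
by ring.
Qed.

Lemma fund_conj_exp m : fund_conj R A al be ^+ m = (U m)%:~R - (V m)%:~R * rt.
Proof.
elim: m => [|m IH]; first by rewrite mul0r subr0.
rewrite exprS IH /fund_conj /= !intrD !intrM -!pmulrn.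
by rewrite -(sqr_rt R A t tauE t_gt1); ring.
Qed.

Lemma fund_expV m : phi ^- m = (U m)%:~R - (V m)%:~R * rt.
Proof.
have n1 : phi ^+ m * ((U m)%:~R - (V m)%:~R * rt) = 1.
  rewrite fund_exp mulrC -subr_sqr exprMn (sqr_rt R A t tauE t_gt1).
  by rewrite -[RHS](mulr1z 1) -(pell_norm t al be ab1 m) rmorphB rmorphXn
    rmorphM rmorphXn (mulrC t%:~R).
have p0 : phi ^+ m != 0.
  by apply: contra_eq_neq n1 => ->; rewrite mul0r eq_sym oner_eq0.
by apply: (mulfI p0); rewrite n1 mulfV.
Qed.

Lemma fund_gt1 : 1 < phi.
Proof.
have : 1%:~R <= (al%:Z)%:~R :> R by rewrite ler_int; lia.
have r1 := rt_gt1 R A t tauE t_gt1.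
have : 0 < be%:R * rt.
  by rewrite mulr_gt0 ?ltr0n //; lra.
by rewrite /fund -!pmulrn; lra.
Qed.

Lemma useqE m : useq R A al be m = (U m)%:~R.
Proof. by rewrite /useq fund_exp fund_conj_exp; field. Qed.

Lemma vseqE m : vseq R A al be m = (V m)%:~R.
Proof.
have r1 := rt_gt1 R A t tauE t_gt1.
by rewrite /vseq fund_exp fund_conj_exp; field; lra.
Qed.

Lemma absK_lt_rt : (`|k|%:~R < rt) = (k ^+ 2 < t).
Proof.
rewrite intr_norm -sqrtr_sqr ltr_sqrt; last by rewrite tauE ltr0z; lia.
by rewrite tauE -rmorphXn ltr_int.
Qed.

Lemma N0_setE m : N0_set R A al be m <->
  [/\ (0 < m)%N, `|kap| < pell_gap t al be k m & `|e| < V m].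
Proof.
rewrite /N0_set /= useqE vseqE EoDE hdE lamE absEoDE -intrM -intrB -!intr_norm.
rewrite absK_lt_rt -intrM -intrD -intrB !ltr_int /pell_gap.
by case: (k ^+ 2 < t); split=> [[m0 [g v]]|[m0 g v]];
  split=> //; try split=> //; lia.
Qed.

Lemma N0_exists : exists N0, is_min (N0_set R A al be) N0.
Proof.
have [m m0 hm] := pell_gap_unbounded _ _ _ t_gt1 al_gt0 be_gt0 ab1 _ k2_neq_t
  (`|kap| + `|e|).
(* The first entry of the maximum makes the gap large enough; the second gives [|e| < V], since V_m
   is at least m. *)
have ex : exists n, `[< N0_set R A al be n >].
  exists (maxn m `|e|.+1); apply/asboolP/N0_setE; split.
  - by rewrite leq_max m0.
  - apply: lt_le_trans
      (pell_gap_le _ _ _ t_gt1 al_gt0 be_gt0 ab1 _ k2_neq_t _ _ m0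
        (leq_maxl _ _)).
    by apply: le_lt_trans hm; lia.
  - have := pellV_ge _ _ _ t_gt1 al_gt0 be_gt0 ab1 (maxn m `|e|.+1).
    by have := leq_maxr m `|e|.+1; lia.
have [n /asboolP nS nmin] := ex_minnP ex.
by exists n; split=> // i iS; apply/nmin/asboolP.
Qed.

(* On branch l, W = et l * sg l * u_m and V = et l * v_m. *)
Definition sg (l : nat) : int := (-1) ^+ l.-1.
Definition et (l : nat) : int := (-1) ^+ l.-1./2.

Definition sint (l m : nat) : int := et l * (sg l * U m - k * V m) + kap.
Definition tint (l m : nat) : int := et l * V m - e.

Lemma signr_or (n : nat) : (-1 : int) ^+ n = 1 \/ (-1 : int) ^+ n = -1.
Proof. by rewrite -signr_odd; case: odd; [right|left]. Qed.

Lemma sgE l : (-1) ^+ l.-1 = (sg l)%:~R :> R.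
Proof. by rewrite /sg rmorphXn rmorphN1. Qed.

Lemma sgSE l : (0 < l)%N -> (-1) ^+ l = - (sg l)%:~R :> R.
Proof. by case: l => // l _; rewrite -sgE exprS mulN1r. Qed.

Lemma etE l : (-1) ^+ l.-1./2 = (et l)%:~R :> R.
Proof. by rewrite /et rmorphXn rmorphN1. Qed.

Lemma etSE l : (0 < l)%N -> (-1) ^+ l.+1./2 = - (et l)%:~R :> R.
Proof. by case: l => // l _; rewrite -etE /= exprS mulN1r. Qed.

(** The two floors, of l/2 and of (l-1)/2, add up to l - 1. *)
Lemma et_sgE l : (0 < l <= 4)%N -> (-1) ^+ l./2 = (et l)%:~R * (sg l)%:~R :> R.
Proof.
rewrite -sgE -etE.
by case: l => [|[|[|[|[|l]]]]] //= _; rewrite -exprD /= ?expr0 // !exprS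
  expr0; ring.
Qed.

Lemma sseqE l m : (0 < l <= 4)%N -> sseq R A al be l m = (sint l m)%:~R.
Proof.
move=> l4; rewrite /sseq et_sgE // etE useqE vseqE EoDE lamE hdE /sint.
by rewrite !(intrD, intrM, intrN); ring.
Qed.

Lemma tseqE l m : tseq R A al be l m = (tint l m)%:~R.
Proof. by rewrite /tseq etE vseqE EoDE /tint intrB intrM. Qed.

Lemma Nl_gt0 l : (0 < Nl R A al be l)%N.
Proof.
rewrite /Nl; case: ifP => // _; set z := Num.ceil _.
by rewrite /Order.max; case: ifP; lia.
Qed.

Local Notation size l m := (`|sint l m| + `|tint l m|).

(** The integer form of M'_l, from which the final bound is obtained as a natural number. *)
Definition Mint (N0 l : nat) : int :=
  Num.max (Num.max `|sint l 1| `|sint l N0|) `|sint l (Nl R A al be l)| +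
  Num.max (Num.max `|tint l 1| `|tint l N0|) `|tint l (Nl R A al be l)|.

Lemma MbdE N0 l : (0 < l <= 4)%N -> Mbd R A al be N0 l = (Mint N0 l)%:~R.
Proof.
move=> l4; rewrite /Mbd !sseqE // !tseqE -!intr_norm -!intr_max -intrD.
by [].
Qed.

Local Notation o l := (dom_sign t k (sg l)).
Local Notation G l m := (o l * (sg l * U m - k * V m)).

Let o1 l : o l = 1 \/ o l = -1 :=
  dom_signP _ _ _ t_gt1 al_gt0 be_gt0 ab1 _ k2_neq_t _ (signr_or _).

(** This exhibits s_m as a sign times a nondecreasing sequence plus a constant, the shape required
    by [ler_norm_mid]. *)
Lemma sintE l m : sint l m = (o l * et l) * G l m + kap.
Proof. by rewrite /sint; case: (o1 l) => ->; ring. Qed.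

Lemma oet1 l : o l * et l = 1 \/ o l * et l = -1.
Proof.
by case: (o1 l) => ->; case: (signr_or l.-1./2); rewrite /et => ->; lia.
Qed.

Lemma G_mono l m n : (m <= n)%N -> G l m <= G l n.
Proof.
apply: (homo_leq (f := fun i => G l i) (@lexx _ _) (@le_trans _ _)) => i.
exact: (dom_mono _ _ _ t_gt1 al_gt0 be_gt0 ab1 _ k2_neq_t _ _ (signr_or _)).
Qed.

Lemma V_mono m n : (m <= n)%N -> V m <= V n.
Proof.
apply: (homo_leq (f := fun i => V i) (@lexx _ _) (@le_trans _ _)) => i.
exact/ltW/(pellV_lt _ _ _ t_gt1 al_gt0 be_gt0 ab1).
Qed.

Lemma size_le_Mint N0 l m : (0 < m <= maxn N0 (Nl R A al be l))%N ->
  size l m <= Mint N0 l.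
Proof.
move=> /andP[m0 mM].
have [n [nN mn]] : exists n, (n = N0 \/ n = Nl R A al be l) /\ (m <= n)%N.
  by move: mM; rewrite leq_max => /orP[mn|mn];
    [exists N0|exists (Nl R A al be l)]; auto.
have sm := ler_norm_mid _ _ _ kap _ (oet1 l) (G_mono l _ _ m0)
  (G_mono l _ _ mn).
have tm := ler_norm_mid _ _ _ (- e) _ (signr_or l.-1./2) (V_mono _ _ m0)
  (V_mono _ _ mn).
rewrite -!sintE in sm; rewrite /Mint; apply: lerD.
  apply: (le_trans sm); rewrite ge_max !le_max lexx /=.
  by case: nN => <-; rewrite lexx ?orbT.
apply: (le_trans tm); rewrite -/(et l) -!/(tint l _) ge_max !le_max lexx /=.
by case: nN => <-; rewrite lexx ?orbT.
Qed.

(** Beyond N_0 the varying parts outweigh the constants [kap] and [e], so both absolute values open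
    with fixed signs. The constant left over is Q_l. *)
Lemma size_eventually N0 l m : N0_set R A al be N0 -> (N0 <= m)%N ->
  size l m = G l m + V m + et l * (o l * kap - e).
Proof.
move=> /N0_setE[N00 gN VN] Nm.
have VN' := lt_le_trans VN (V_mono _ _ Nm).
have GN := lt_le_trans gN (pell_gap_le _ _ _ t_gt1 al_gt0 be_gt0 ab1 _ k2_neq_t
  _ _ N00 Nm).
have := lt_le_trans GN (pell_gap_le_dom _ _ _ t_gt1 al_gt0 be_gt0 ab1 _
  k2_neq_t _ m (signr_or l.-1)).
rewrite -/(sg l) sintE /tint; move: (G l m) => g gm.
by case: (o1 l) => ->; case: (signr_or l.-1./2); rewrite -/(et l) => ->; lia.
Qed.

(** * The constants P_l, Q_l, R_l and N_l *)

Local Notation kR := (k%:~R : R).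
Local Notation oR l := ((o l)%:~R : R).
Local Notation gR l := ((sg l)%:~R : R).
(** The coefficient of phi^-m in 2 sqrt tau (G + V): minus the conjugate of P_l. *)
Local Notation P' l := (oR l * (gR l * rt + kR) - 1).

Lemma abs_lamE : `|lam R A| = `|k|%:~R.
Proof. by rewrite lamE intr_norm. Qed.

Lemma rt_lt_absK : ~~ (k ^+ 2 < t) -> rt < `|k|%:~R.
Proof.
move=> kt'; rewrite lt_neqAle (rt_neq_int R A t tauE t_gt1 t_nonsquare) /=.
by rewrite leNgt absK_lt_rt.
Qed.

(** The case distinction in P_l and Q_l is thus the sign of the dominant term, which merges both
    cases into single formulas. *)
Lemma dom_lt l :
  (lam R A < gR l * rt) = (o l == 1).
Proof.
have r1 := rt_gt1 R A t tauE t_gt1.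
rewrite lamE /dom_sign; have := absK_lt_rt; have := rt_lt_absK.
case: (ltP (k ^+ 2) t) => _ /= h1 h2.
  have {h1 h2} : `|kR| < rt by rewrite -intr_norm h2.
  rewrite ltr_norml => /andP[h1 h2].
  by case: (signr_or l.-1); rewrite -/(sg l) => -> /=;
    [rewrite mul1r h2 | apply/negbTE; rewrite -leNgt; lra].
have := h1 isT; rewrite intr_norm; case: sgzP => k0.
- by rewrite k0 normr0; lra.
- rewrite gtr0_norm ?ltr0z // => kr.
  by apply/negbTE; case: (signr_or l.-1); rewrite -/(sg l) => -> /=;
    rewrite -leNgt; lra.
- rewrite ltr0_norm ?ltrz0 // => kr.
  by rewrite opprK eqxx; case: (signr_or l.-1); rewrite -/(sg l) => ->; lra.
Qed.

Lemma PcE l : (0 < l)%N -> Pc R A l = 1 + oR l * (gR l * rt - kR).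
Proof.
move=> l0; rewrite /Pc sgE sgSE // dom_lt lamE.
by case: (o1 l) => -> /=; ring.
Qed.

Lemma QcE l : (0 < l)%N -> Qc R A l = (et l * (o l * kap - e))%:~R.
Proof.
move=> l0; rewrite /Qc sgE etE etSE // dom_lt lamE EoDE hdE.
by rewrite !(intrD, intrM, intrN); case: (o1 l) => -> /=; ring.
Qed.

(** By [dom_lt], P_l = 1 + |sg sqrt tau - lambda|. *)
Lemma Pc_gt0 l : (0 < l)%N -> 0 < Pc R A l.
Proof.
move=> l0; rewrite PcE //; have := dom_lt l; rewrite lamE.
case: (o1 l) => -> /= hl.
  have {}hl : kR < gR l * rt by rewrite hl.
  by lra.
by move/negbT: hl; rewrite -leNgt; lra.
Qed.

(** For |lambda| > sqrt tau, the left side is -P'_l, as [o l] is opposite to the sign of lambda. The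
    bound exponentiates the ceiling in N_l. *)
Lemma le_fund_Nl l : ~~ (k ^+ 2 < t) -> (0 < l)%N ->
  1 + `|kR| + oR l * (- gR l) * rt <= 2 * rt * phi ^+ Nl R A al be l.
Proof.
move=> kt' l0; have kr := rt_lt_absK kt'.
have r1 := rt_gt1 R A t tauE t_gt1; have p1 := fund_gt1.
have k0 : `|kR| != 0 by rewrite gt_eqF // -intr_norm; lra.
have sgl : `|lam R A| / lam R A = - oR l.
  rewrite lamE /dom_sign (negbTE kt') mulrNz opprK.
  have kn0 : kR != 0 by rewrite -normr_eq0.
  case: sgzP => s; first by rewrite s eqxx in kn0.
    by rewrite gtr0_norm ?ltr0z // divff.
  by rewrite ltr0_norm ?ltrz0 // mulNr divff.
rewrite /Nl sgl abs_lamE absK_lt_rt (negbTE kt') sgSE //.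
set X := 1 + `|k|%:~R - _; set z := _ / ln phi.
have -> : 1 + `|kR| + oR l * (- gR l) * rt = X by rewrite /X intr_norm; ring.
have X0 : 0 < X.
  rewrite /X; case: (o1 l) => ->; case: (signr_or l.-1); rewrite -/(sg l) => ->;
    rewrite /=; lra.
have p0 : 0 < phi by lra.
have rt0 : 0 < rt by lra.
have c0 : 0 < 2 * rt by lra.
set n := `|_|%N.
have zn : z <= n%:R.
  apply: le_trans (ceil_ge z) _; rewrite pmulrn ler_int /n.
  rewrite gez0_abs; first by rewrite le_max lexx orbT.
  by rewrite le_max.
move: zn; rewrite /z ler_pdivrMr ?ln_gt0 // lerBlDl => zn.
rewrite -ler_ln ?posrE ?mulr_gt0 ?exprn_gt0 //.
by rewrite lnM ?posrE ?exprn_gt0 // lnXn // -[_ *+ n]mulr_natl //; lra.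
Qed.

(** R_l records the sign of P'_l. If |lambda| < sqrt tau, then P'_l = sqrt tau + sg lambda - 1 lies
    between -1 and 2 sqrt tau; otherwise it is negative and [le_fund_Nl] applies. *)
Lemma Rc_cases l : (0 < l)%N ->
  (Rc R A l = 1 /\ 0 < P' l < 2 * rt) \/
  [/\ Rc R A l = 0, P' l < 0 & - P' l <= 2 * rt * phi ^+ Nl R A al be l].
Proof.
move=> l0; have r1 := rt_gt1 R A t tauE t_gt1; have p1 := fund_gt1.
rewrite /Rc sgSE // lamE.
have p2 : 1 <= phi ^+ Nl R A al be l by rewrite exprn_ege1 // ltW.
have le_Nl := le_fund_Nl l.
move: (phi ^+ Nl R A al be l) p2 le_Nl => p p2 le_Nl.
have [kt'|kt'] := boolP (k ^+ 2 < t); last first.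
  have := rt_lt_absK kt'; have := le_Nl kt' l0; move: le_Nl => _.
  rewrite /dom_sign (negbTE kt') intr_norm.
  case: sgzP => k0.
  - by rewrite k0 normr0; lra.
  - rewrite gtr0_norm ?ltr0z // => le_Nl kr; right.
    move: le_Nl; case: (signr_or l.-1); rewrite -/(sg l) => -> le_Nl;
      (split; last by lra); rewrite /= ?ifF; lra.
  - rewrite ltr0_norm ?ltrz0 // => le_Nl kr; right.
    move: le_Nl; case: (signr_or l.-1); rewrite -/(sg l) => -> le_Nl;
      (split; last by lra); rewrite /= ?ifF; lra.
have : `|kR| < rt by rewrite -intr_norm absK_lt_rt.
rewrite ltr_norml => /andP[k1 k2].
move: le_Nl => _; have p3 : 2 * rt * 1 <= 2 * rt * p.
  by rewrite ler_pM2l //; lra.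
rewrite /dom_sign kt'.
(* Irrationality of sqrt tau excludes P'_l = 0. *)
have n1 := rt_neq_int R A t tauE t_gt1 t_nonsquare (1 - k).
have n2 := rt_neq_int R A t tauE t_gt1 t_nonsquare (1 + k).
rewrite rmorphB /= in n1; rewrite rmorphD /= in n2.
case: (signr_or l.-1); rewrite -/(sg l) => ->; case: ifP => /=.
- by move=> /andP[? ?]; left; split=> //; apply/andP; split; lra.
- move=> /negbT; rewrite negb_and -!leNgt => H; right; split=> //; last by lra.
  by move: n1 H; rewrite neq_lt => /orP[?|?] /orP[?|?]; lra.
- by move=> /andP[? ?]; left; split=> //; apply/andP; split; lra.
- move=> /negbT; rewrite negb_and -!leNgt => H; right; split=> //; last by lra.
  by move: n2 H; rewrite neq_lt => /orP[?|?] /orP[?|?]; lra.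
Qed.

Lemma size_le_iff N0 l (x : R) m : (0 < l <= 4)%N -> N0_set R A al be N0 ->
  Mbd R A al be N0 l <= x -> (0 < m)%N ->
  (size l m)%:~R <= x <-> m%:Z <= mbound A al be l x.
Proof.
move=> l4 N0S Mx m0; have l0 : (0 < l)%N by case/andP: l4.
have r1 := rt_gt1 R A t tauE t_gt1; have p1 := fund_gt1.
have c0 : 0 < 2 * rt by lra.
rewrite /mbound QcE //.
(* From N_0 on the closed form of the size holds; from N_l on its conjugate term is small enough. *)
apply: (@le_iff_le_floor_log R phi (2 * rt) (Pc R A l) (P' l) (Rc R A l) x
  _ (fun i => size l i) (maxn N0 (Nl R A al be l))) => //.
- exact: Pc_gt0.
- by rewrite leq_max Nl_gt0 orbT.
- move=> i iM; apply: le_trans Mx.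
  by rewrite MbdE // ler_int size_le_Mint.
- move=> i; rewrite geq_max => /andP[N0i _].
  rewrite (size_eventually N0) // PcE // fund_expV fund_exp.
  by rewrite !(intrD, intrM, intrN, intrB); field; lra.
- case: (Rc_cases l l0) => [|[r0 P0 PN]]; [by left|right; split=> //].
  apply: (le_trans PN); rewrite ler_pM2l //.
  by rewrite ler_eXn2l // leq_maxr.
Qed.

(** * The full solution set and its bounded part *)

Hypothesis solE : forall u v, is_sol A u v <->
  (u + k * v + h) ^+ 2 - t * (v + e) ^+ 2 = 1.
Hypothesis be_min : forall w v : int,
  0 < w -> 0 < v -> w ^+ 2 - t * v ^+ 2 = 1 -> be%:Z <= v.

(* On the branch where both terms of the shift +-u_1 +- k v_1 have the sign of
   e k - h, the first coordinate gains u_1 > v_1, which outweighs the possible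
   loss v_1 in the second. *)
Lemma base_size_le : exists2 l, (0 < l <= 4)%N & `|kap| + 1 + `|e| <= size l 1.
Proof.
have [u0 v0] := pell_pos _ _ _ t_gt1 al_gt0 be_gt0 ab1 1.
have vu := pellV_lt_U _ _ _ t_gt1 al_gt0 be_gt0 ab1 1.
rewrite /sint /tint; move: (U 1) (V 1) u0 v0 vu => u v u0 v0 vu.
have [kap0|kap0] := leP 0 kap; have [k0|k0] := ltP 0 k.
- exists 4%N => //; have : 0 <= k * v by rewrite mulr_ge0; lia.
  by rewrite /et /sg /=; lia.
- exists 1%N => //; have : k * v <= 0 by rewrite mulr_le0_ge0; lia.
  by rewrite /et /sg /=; lia.
- exists 2%N => //; have : 0 <= k * v by rewrite mulr_ge0; lia.
  by rewrite /et /sg /=; lia.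
- exists 3%N => //; have : k * v <= 0 by rewrite mulr_le0_ge0; lia.
  by rewrite /et /sg /=; lia.
Qed.

Lemma sint_tint_sol l m : is_sol A (sint l m) (tint l m).
Proof.
apply/solE; rewrite -(pell_norm t al be ab1 m) /sint /tint.
by case: (signr_or l.-1); rewrite -/(sg l) => ->;
  case: (signr_or l.-1./2); rewrite -/(et l) => ->; ring.
Qed.

Lemma sol_cases u v : is_sol A u v ->
  (v = - e /\ (u = 1 + kap \/ u = -1 + kap)) \/
  exists l m, [/\ (0 < l <= 4)%N, (0 < m)%N, u = sint l m & v = tint l m].
Proof.
move/solE; set W := _ + h; set X := v + e => WX.
have uE : u = W - k * X + kap by rewrite /W /X; ring.
have vE : v = X - e by rewrite /X; ring.
have [X0|X0] := eqVneq X 0.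
  left; rewrite uE vE X0; split; first by ring.
  have : W ^+ 2 == 1 by rewrite -WX X0; apply/eqP; ring.
  by rewrite sqrf_eq1 => /orP[] /eqP ->; [left|right]; ring.
have W0 : W != 0.
  apply: contra_eq_neq WX => ->.
  have : 0 <= t * X ^+ 2 by rewrite mulr_ge0 ?sqr_ge0 //; lia.
  by lia.
have nWX : `|W| ^+ 2 - t * `|X| ^+ 2 = 1 by rewrite !real_normK ?num_real.
move: (W0) (X0); rewrite -!normr_gt0 => nW nX.
right; have [m [wm vm]] := pell_complete _ _ _ t_gt1 al_gt0 be_gt0 ab1
  _ _ be_min nW nX nWX.
move: wm vm; rewrite uE vE /sint /tint.
(* The signs of (W, X) select the branch: (+,+) is 1, (+,-) is 4, (-,+) is 2, (-,-) is 3. *)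
case: (ltrgt0P W) W0 => // _ _; case: (ltrgt0P X) X0 => // _ _ wm xm.
- by exists 1%N, m.+1; split=> //; rewrite -?wm -?xm /et /sg /=; ring.
- by exists 4%N, m.+1; split=> //; rewrite -?wm -?xm /et /sg /=; ring.
- by exists 2%N, m.+1; split=> //; rewrite -?wm -?xm /et /sg /=; ring.
- by exists 3%N, m.+1; split=> //; rewrite -?wm -?xm /et /sg /=; ring.
Qed.

Lemma description N0 (x : R) : N0_set R A al be N0 ->
  (forall l, (0 < l <= 4)%N -> Mbd R A al be N0 l <= x) ->
  description_at A al be x.
Proof.
move=> N0S Mx.
(* The exceptional points have no index m, so their size is compared with that of a first branch
   point. *)
have base_x : (`|kap| + 1 + `|e|)%:~R <= x.
  have [l l4 le_l] := base_size_le; apply: le_trans (Mx l l4).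
  rewrite MbdE // ler_int; apply: (le_trans le_l); apply: size_le_Mint.
  by rewrite leq_max Nl_gt0 orbT.
have kapR : EoD R A * lam R A - hd R A = kap%:~R.
  by rewrite EoDE lamE hdE intrB intrM.
have base_sol i : i = 1 \/ i = -1 ->
    exists2 p, sol_set A x p & (p.1%:~R, p.2%:~R) =
      (i%:~R + EoD R A * lam R A - hd R A, - EoD R A).
  move=> i1; exists (i + kap, - e) => /=; last first.
    by rewrite -addrA kapR intrD EoDE intrN.
  split=> /=.
    apply/solE; rewrite (_ : _ + h = i); last by ring.
    by case: i1 => ->; ring.
  apply: le_trans base_x; rewrite -intrD ler_int.
  by case: i1 => ->; lia.
apply/seteqP; split=> [_ [[u v] [/= sol uvx] <-]|].
  case: (sol_cases _ _ sol) => [[-> uE]|[l [m [l4 m0 uE vE]]]].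
    left; case: uE => ->; [left|right]; rewrite /= intrD -kapR EoDE intrN.
      by rewrite addrA.
    by rewrite addrA.
  right; exists l => //; exists m.
    split=> //; apply/(size_le_iff N0) => //; first exact: Mx.
    by rewrite intrD -uE -vE.
  by rewrite sseqE // tseqE uE vE.
move=> _ [[->|->]|[l l4 [m [m0 mx] <-]]].
- have [p psol pE] := base_sol 1 (or_introl erefl).
  by exists p.
- have [p psol pE] := base_sol (-1) (or_intror erefl).
  by exists p.
- exists (sint l m, tint l m); last by rewrite /= sseqE // tseqE.
  split; first exact: sint_tint_sol.
  by rewrite /= -intrD; apply/(size_le_iff N0) => //; exact: Mx.
Qed.

(** This makes the final bound a positive integer: the branch from [base_size_le] already has size
    at least 1 at m = 1. *)
Lemma Mint_gt0 N0 : exists2 l, (0 < l <= 4)%N & 0 < Mint N0 l.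
Proof.
have [l l4 le_l] := base_size_le; exists l => //.
have := size_le_Mint N0 l 1; rewrite leq_max Nl_gt0 orbT => /(_ isT).
by lia.
Qed.

End Branches.

Theorem theorem1p5 (R : realType) (A : quad_eq) (hA : in_Z1 A)
  (alpha beta : nat) (hfund : is_fundamental R A alpha beta) :
  (exists L : nat, (0 < L)%N /\
     forall x : R, L%:R <= x -> description_at A alpha beta x)
  /\
  (exists N0 : nat, is_min (N0_set R A alpha beta) N0 /\
     exists L : nat,
       [/\ (0 < L)%N, L%:R = maxMbd R A alpha beta N0 &
           forall x : R, L%:R <= x -> description_at A alpha beta x]).
Proof.
have [t [k [e [h [t1 tns [bE dE DE EE] solE]]]]] := in_Z1_pell A hA.
have lamE : lam R A = k%:~R by rewrite /lam bE intrM; field.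
have tauE : tau R A = t%:~R by rewrite /tau DE intrM; field.
have hdE : hd R A = h%:~R by rewrite /hd dE intrM; field.
have t0 : t%:~R != 0 :> R by rewrite intr_eq0; lia.
have EoDE : EoD R A = e%:~R by rewrite /EoD EE DE !intrM; field.
have absEoDE : `|(discE A)%:~R| / (discD A)%:~R = `|e|%:~R :> R.
  have D0 : 0 < (4 * t)%:~R :> R by rewrite ltr0z; lia.
  rewrite EE DE intrM normrM (gtr0_norm D0) [LHS]mulrC mulKf ?gt_eqF //.
  by rewrite intr_norm.
have [ab1 al0 be0 be_min] := fundamental_pell _ _ _ tauE t1 tns _ _ hfund.
have [N0 [N0S N0min]] := N0_exists R A t k e h alpha beta t1 tns lamE tauE
  EoDE hdE absEoDE al0 be0 ab1.
pose M l := Mint R A t k e h alpha beta N0 l.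
have ME l : (0 < l <= 4)%N -> Mbd R A alpha beta N0 l = (M l)%:~R.
  exact: MbdE.
have [l0 l04 Ml0] : exists2 l, (0 < l <= 4)%N & 0 < M l.
  exact: Mint_gt0 R A t k e h alpha beta t1 tns al0 be0 ab1 N0.
clearbody M.
(* The maximum is positive, so the absolute value only converts it to [nat]; this [L] serves both
   claims. *)
pose L := `|Num.max (Num.max (M 1%N) (M 2)) (Num.max (M 3) (M 4))|%N.
have le_max4 l : (0 < l <= 4)%N ->
    M l <= Num.max (Num.max (M 1%N) (M 2)) (Num.max (M 3) (M 4)).
  by case: l => [|[|[|[|[|l]]]]] // _; rewrite !le_max lexx ?orbT.
have max_gt0 := lt_le_trans Ml0 (le_max4 l0 l04).
have L0 : (0 < L)%N by rewrite absz_gt0 gt_eqF.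
have LE : L%:R = maxMbd R A alpha beta N0.
  by rewrite /maxMbd !ME // -!intr_max pmulrn /L gez0_abs // ltW.
have desc (x : R) : L%:R <= x -> description_at A alpha beta x.
  move=> Lx; apply: (@description R A t k e h alpha beta) N0S _ => // l l4.
  rewrite ME //; apply: le_trans Lx; rewrite pmulrn ler_int.
  by rewrite /L gez0_abs ?le_max4 // ltW.
split; first by exists L.
by exists N0; split=> //; exists L.
Qed.
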